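(* Let $a,b,c\in\mathbb{Q}^\times$, let $n$ be a positive integer, and let $X$ be the projective plane curve defined by $ax^n+by^n+cz^n=0$. Let $K$ be a field of characteristic zero whose absolute Galois group $G_K$ is (topologically) finitely generated. If $X(K)\neq\emptyset$, then $X(K)$ is infinite.
   Context: For a field $K$ of characteristic zero, $G_K=\mathrm{Gal}(\bar K/K)$ is the absolute Galois group of $K$, regarded as a profinite group; ''finitely generated'' means that some finite subset generates a dense subgroup. $X(K)$ is the set of points $(x:y:z)\in\mathbb{P}^2(K)$ with $ax^n+by^n+cz^n=0$. *)

(* Defs.v *)
From HB Require Import structures.
From mathcomp Require Import all_boot all_algebra.
From mathcomp Require Import boolp classical_sets functions cardinality topology.

Set Implicit Arguments.
Unset Strict Implicit.
Unset Printing Implicit Defensive.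

Import GRing.Theory.
Local Open Scope classical_set_scope.
Local Open Scope quotient_scope.
Local Open Scope ring_scope.

Definition nonzero_vec (K : fieldType) (m : nat) := {v : 'rV[K]_m.+1 | v != 0}.

Section Projective.
Variables (K : fieldType) (m : nat).

Definition proportional (u v : nonzero_vec K m) : bool :=
  `[< exists2 k : K, k != 0 & val v = k *: val u >].

Lemma proportional_refl : reflexive proportional.
Proof. by move=> u; apply/asboolP; exists 1; rewrite ?oner_eq0 ?scale1r. Qed.

Lemma proportional_sym : symmetric proportional.
Proof.
have H u v : proportional u v -> proportional v u.
  move=> /asboolP[k k0 E]; apply/asboolP; exists k^-1; rewrite ?invr_eq0//.
  by rewrite E scalerA mulVf// scale1r.
by move=> u v; apply/idP/idP; exact: H.
Qed.

Lemma proportional_trans : transitive proportional.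
Proof.
move=> v u w /asboolP[k k0 E] /asboolP[l l0 F]; apply/asboolP.
by exists (l * k); rewrite ?mulf_neq0// F E scalerA.
Qed.

Canonical proportional_equiv :=
  EquivRel proportional proportional_refl proportional_sym proportional_trans.

Definition proj_space := {eq_quot proportional}.

End Projective.

(* a x^n + b y^n + c z^n at v = (x, y, z). *)
Definition fermat_form (a b c : rat) (n : nat) (K : fieldType) (v : 'rV[K]_3) : K :=
  ratr a * v 0 0 ^+ n + ratr b * v 0 1 ^+ n + ratr c * v 0 2%:R ^+ n.

Definition fermat_points (a b c : rat) (n : nat) (K : fieldType) :
    set (proj_space K 2) :=
  [set \pi_(proj_space K 2) v |
    v in [set v : nonzero_vec K 2 | fermat_form a b c n (val v) = 0]].

(* Membership does not depend on the homogeneous coordinates chosen. *)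
Lemma fermat_points_pi (a b c : rat) (n : nat) (K : fieldType)
    (v : nonzero_vec K 2) :
  fermat_points a b c n (\pi_(proj_space K 2) v) <->
  fermat_form a b c n (val v) = 0.
Proof.
split=> [[u /= u0 /eqmodP/asboolP[k k0 ->]]|v0]; last by exists v.
rewrite /fermat_form !mxE !exprMn !(mulrCA _ (k ^+ n)) -!mulrDr.
by rewrite -/(fermat_form a b c n (val u)) u0 mulr0.
Qed.

(* Automorphisms of L that fix the image of K. *)
Record galois_aut (K L : fieldType) (iota : {rmorphism K -> L}) := GaloisAut {
  aut_fun :> {rmorphism L -> L};
  aut_bij : bijective aut_fun;
  aut_fix : forall x : K, aut_fun (iota x) = iota x
}.

Section GaloisGroup.
Variables (K L : fieldType) (iota : {rmorphism K -> L}).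
Local Notation G := (galois_aut iota).

Lemma galois_autP (s t : G) : (s : L -> L) =1 t -> s = t.
Proof.
case: s t => [[s [[s1] [s2]]] sb sf] [[t [[t1] [t2]]] tb tf] /= /funext E.
move: s1 s2 sb sf; rewrite /= E => s1 s2 sb sf.
rewrite (Prop_irrelevance s1 t1) (Prop_irrelevance s2 t2) in sb sf *.
by rewrite (Prop_irrelevance sb tb) (Prop_irrelevance sf tf).
Qed.

HB.instance Definition _ := gen_eqMixin G.
HB.instance Definition _ := gen_choiceMixin G.

Definition galois_one : G :=
  @GaloisAut K L iota idfun (Bijective (fun=> erefl) (fun=> erefl)) (fun=> erefl).

Lemma galois_mul_fix (s t : G) (x : K) : (s \o t) (iota x) = iota x.
Proof. by rewrite /= !aut_fix. Qed.

(* (s * t) x = s (t x) *)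
Definition galois_mul (s t : G) : G :=
  @GaloisAut K L iota (s \o t) (bij_comp (aut_bij s) (aut_bij t))
    (galois_mul_fix s t).

Lemma galois_inv_subproof (s : G) : {t : G | cancel s t /\ cancel t s}.
Proof.
apply/cid; have [f sK fK] := aut_bij s.
have fB : zmod_morphism f by move=> x y; apply: (can_inj sK); rewrite rmorphB !fK.
have fM : monoid_morphism f.
  by split=> [|x y]; apply: (can_inj sK); rewrite ?rmorphM ?rmorph1 !fK.
pose f1 := GRing.isZmodMorphism.Build L L f fB.
pose f2 := GRing.isMonoidMorphism.Build L L f fM.
pose g : {rmorphism L -> L} := HB.pack f f1 f2.
have gb : bijective g by exists s.
have gf x : g (iota x) = iota x by rewrite -{1}(aut_fix s x); exact: sK.
by exists (GaloisAut gb gf).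
Qed.

Definition galois_inv (s : G) : G := sval (galois_inv_subproof s).

Lemma galois_mulA : associative galois_mul.
Proof. by move=> s t u; exact: galois_autP. Qed.

Lemma galois_mul1 : left_id galois_one galois_mul.
Proof. by move=> s; exact: galois_autP. Qed.

Lemma galois_mulr1 : right_id galois_one galois_mul.
Proof. by move=> s; exact: galois_autP. Qed.

Lemma galois_mulV : left_inverse galois_one galois_inv galois_mul.
Proof.
move=> s; apply: galois_autP => x /=; rewrite /galois_inv.
by case: galois_inv_subproof => t [/= sK _].
Qed.

Lemma galois_mulrV : right_inverse galois_one galois_inv galois_mul.
Proof.
move=> s; apply: galois_autP => x /=; rewrite /galois_inv.
by case: galois_inv_subproof => t [/= _ tK].
Qed.

HB.instance Definition _ := isGroup.Build G
  galois_mulA galois_mul1 galois_mulr1 galois_mulV galois_mulrV.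

(* F is an intermediate field of L / K of finite degree over K. *)
Definition finite_subextension (F : {pred L}) : Prop :=
  [/\ divring_closed F,
      forall x : K, iota x \in F &
      exists d (e : d.-tuple L), {subset e <= F} /\
        forall x, x \in F ->
          exists k : 'I_d -> K, x = \sum_(i < d) iota (k i) * tnth e i].

Definition fixing_subgroup (F : {pred L}) : set G :=
  [set t : G | forall x, x \in F -> t x = x].

(* Subbase of the Krull topology: the cosets s Gal(L/F) with F / K finite. For
   L / K algebraic, composita of finite subextensions make it a base. *)
Definition krull_cosets : set (set G) :=
  [set U | exists (s : G) (F : {pred L}), finite_subextension F /\
             U = [set (s * t)%g | t in fixing_subgroup F]].

HB.instance Definition _ := isSubBaseTopological.Build G krull_cosets id.

End GaloisGroup.

Definition generated_subgroup (G : groupType) (S : set G) : set G :=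
  \bigcap_(H in [set H : {pred G} | group_closed H /\ S `<=` [set` H]]) [set` H].

(* When L is an algebraic closure of K of characteristic 0, galois_aut iota is
   the absolute Galois group of K. *)
Definition galois_topologically_fg (K L : fieldType) (iota : {rmorphism K -> L}) :=
  exists S : set (galois_aut iota),
    finite_set S /\ dense (generated_subgroup S).

(* Main.v *)
(* Once K^* / K^*n is known to be finite, the argument is combinatorial.  Colour K
   by the classes modulo nonzero n-th powers.  Gallai's theorem (the
   multidimensional van der Waerden theorem) gives, for every finite S in K, a
   nonzero k such that all the 1 + k^n s with s in S are n-th powers.  If (x0 : y0 : z0) is on the curve and
   e0, e1, e2 are the three terms of the equation at this point, all nonzero,
   then e0 + e1 + e2 = 0, so that
     e0 + e1 (1 + k^n j e2) + e2 (1 - k^n j e1) = 0   for all j,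
   and the factors are n-th powers for j < N: this gives N points.  If the term
   at one coordinate i vanishes, so that e_p = - e_q, one uses instead
     A_i k^n + e_p (1 + k^n (j + 1) d) + e_q (1 + k^n j d) = 0,  d = - A_i / e_p.

   Finiteness of K^* / K^*n is Kummer theory: choose n-th roots rt x in Kbar.
   If s (rt x) / rt x = s (rt y) / rt y for s in a finite set of topological
   generators, then rt x / rt y is fixed by G_K, hence lies in K, and x / y is
   an n-th power.  There are only finitely many n-th roots of unity.

   That the fixed field of G_K is K requires extending embeddings to all of
   Kbar, which is done by Zorn's lemma. *)
Require Import Defs.
From HB Require Import structures.
From mathcomp Require Import all_boot all_algebra.
From mathcomp Require Import boolp classical_sets functions cardinality topology.

Set Implicit Arguments.
Unset Strict Implicit.
Unset Printing Implicit Defensive.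

Import GRing.Theory.
Local Open Scope classical_set_scope.
Local Open Scope quotient_scope.
Local Open Scope ring_scope.

(** * Gallai's theorem *)

Section Gallai.
Variable V : zmodType.
Implicit Types (S : seq V) (u v s : V) (p : V * nat).

(* The pair p = (u, t) stands for the homothetic copy u + t S, and the point u
   itself is required to have the same colour. *)
Definition monochromatic (C : Type) (c : V -> C) S p :=
  forall s, s \in S -> c (p.1 + s *+ p.2) = c p.1.

(* T is independent of c: the induction colours u by the pattern of colours of
   u + P, where P is the finite set of all points of the copies in T. *)
Definition gallai S := forall C : finType, exists T : seq (V * nat),
  (forall p, p \in T -> 0 < p.2)%N /\
  forall c : V -> C, exists2 p, p \in T & monochromatic c S p.

(* Colour focusing: k copies of S of distinct colours whose extensions by s share
   the same point f.  This is impossible when k exceeds the number of colours. *)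
Lemma color_focusing s S (C : finType) k : gallai S ->
  exists (T : seq (V * nat)) (F : seq V), (forall p, p \in T -> 0 < p.2)%N /\
  forall c : V -> C, (exists2 p, p \in T & monochromatic c (s :: S) p) \/
    exists2 f, f \in F & exists cols : seq C, [/\ uniq cols, size cols = k &
      forall col, col \in cols -> exists p, [/\ p \in T, p.1 + s *+ p.2 = f,
        c p.1 = col & monochromatic c S p]].
Proof.
move=> gS; elim: k => [|k [T [F [T0 TF]]]].
  by exists [::], [:: 0]; split=> // c; right; exists 0; rewrite ?inE//; exists [::].
pose P := F ++ [seq p.1 | p <- T] ++ [seq p.1 + x *+ p.2 | p <- T, x <- S].
have [E [E0 TE]] := gS {ffun 'I_(size P) -> C}.
(* The new copies are old ones translated by [e.1], old ones whose ratio also grows by [e.2], and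
   copies based at a translated focus. For an old focus [f], the last two kinds are focused at
   [e.1 + f + s *+ e.2]. *)
exists ([seq (e.1 + p.1, p.2) | e <- E, p <- T] ++
        [seq (e.1 + p.1, (e.2 + p.2)%N) | e <- E, p <- T] ++
        [seq (e.1 + f, e.2) | e <- E, f <- F]).
exists [seq e.1 + f + s *+ e.2 | e <- E, f <- F]; split.
  move=> p; rewrite !mem_cat => /or3P[] /allpairsP[[e q] /= [eE qT ->]] /=.
  - exact: T0.
  - by rewrite addn_gt0 E0.
  - exact: E0.
move=> c; have [e eE eP] := TE (fun v => [ffun i => c (v + tnth (in_tuple P) i)]).
have {}eP x q : x \in S -> q \in P -> c (e.1 + x *+ e.2 + q) = c (e.1 + q).
  move=> xS /(nthP 0)[i iP <-]; move/ffunP/(_ (Ordinal iP)): (eP _ xS).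
  by rewrite !ffunE (tnth_nth 0).
have FP f : f \in F -> f \in P by move=> fF; rewrite mem_cat fF.
have [[p pT pm]|[f fF [cols [ucols scols colsP]]]] := TF (fun v => c (e.1 + v)).
  left; exists (e.1 + p.1, p.2).
    by rewrite mem_cat; apply/orP; left; apply/allpairsP; exists (e, p).
  by move=> x xS /=; rewrite -addrA pm.
(* If the translated focus has the colour of one of the copies, that copy extends by [s]; otherwise
   the focus is the base of a copy of a new colour. *)
have [/colsP[p [pT pf pc pm]]|cN] := boolP (c (e.1 + f) \in cols).
  left; exists (e.1 + p.1, p.2).
    by rewrite mem_cat; apply/orP; left; apply/allpairsP; exists (e, p).
  move=> x; rewrite inE => /predU1P[->|xS] /=; rewrite -addrA ?pf ?pm//.
right; exists (e.1 + f + s *+ e.2); first by apply/allpairsP; exists (e, f).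
exists (c (e.1 + f) :: cols); split; [by rewrite /= cN|by rewrite /= scols|].
move=> col; rewrite inE => /predU1P[->|/colsP[p [pT pf pc pm]]].
  exists (e.1 + f, e.2); split=> //.
    by rewrite !mem_cat; apply/or3P/Or33/allpairsP; exists (e, f).
  by move=> x xS /=; rewrite addrAC eP// FP.
exists (e.1 + p.1, (e.2 + p.2)%N); split=> //=.
- by rewrite !mem_cat; apply/or3P/Or32/allpairsP; exists (e, p).
- by rewrite mulrnDr addrACA pf addrAC.
- move=> x xS /=; rewrite mulrnDr addrACA eP ?pm//.
  by rewrite !mem_cat; apply/or3P/Or33/allpairsP; exists (p, x).
Qed.

Lemma gallai_seq S : gallai S.
Proof.
elim: S => [|s S gS] C.
  exists [:: (0, 1%N)]; split=> [p|c]; first by rewrite inE => /eqP->.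
  by exists (0, 1%N); rewrite ?inE.
have [T [F [T0 TF]]] := color_focusing s C #|C|.+1 gS.
exists T; split=> // c; have [//|[f _ [cols [ucols scols _]]]] := TF c.
by have := max_card (mem cols); rewrite (card_uniqP ucols) scols ltnn.
Qed.

Theorem gallai_witt S (C : finType) (c : V -> C) :
  exists (u : V) (t : nat), (0 < t)%N /\ forall s, s \in S -> c (u + s *+ t) = c u.
Proof.
have [T [T0 /(_ c)[[u t] utT m]]] := gallai_seq S C.
by exists u, t; split; [exact: (T0 _ utT)|exact: m].
Qed.

End Gallai.

(** * Points on diagonal curves *)

(** Finiteness of the group of n-th power classes, as a colouring that may be finer than the
    classes. Since [k] is nonzero, 0 has a colour of its own. *)
Definition finite_power_classes (K : fieldType) (n : nat) :=
  exists (C : finType) (c : K -> C), forall x y, c x = c y ->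
    exists2 k, k != 0 & x = y * k ^+ n.

Section PowerClasses.
Variables (K : fieldType) (n : nat).
Hypotheses (charK0 : [pchar K] =i pred0) (fpc : finite_power_classes K n).

(** If [u + t s w = u l^n] and [t w = u k^n] with [u] nonzero, then [1 + k^n s = l^n]. Gallai's
    theorem supplies the first equation, the choice of [w] the second. *)
Lemma power_shift (S : seq K) : exists (k : K) (l : K -> K), k != 0 /\
  forall s, s \in S -> 1 + k ^+ n * s = l s ^+ n.
Proof.
suff [k k0 kS] : exists2 k : K, k != 0 &
    forall s, s \in S -> exists l, 1 + k ^+ n * s = l ^+ n.
  exists k, (fun s => xget 0 [set l | 1 + k ^+ n * s = l ^+ n]); split=> // s sS.
  exact: (@xgetPex _ 0 [set l | 1 + k ^+ n * s = l ^+ n] (kS s sS)).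
have [C [c cP]] := fpc.
(* The representatives w i of all colours are included among the multipliers of
   S, so that one of them moves t w into the class of u. *)
pose w i := xget 0 [set x | c x = i].
have cw x : c (w (c x)) = c x by exact: (@xgetPex _ 0 [set y | c y = c x] (ex_intro _ x erefl)).
have [u [t [t0 ut]]] := gallai_witt (1 :: [seq s * w i | s <- S, i <- enum C]) c.
have t_neq0 : t%:R != 0 :> K.
  by rewrite (proj1 (pcharf0P K) charK0) -lt0n.
(* Ensured by the multiplier 1: if [u = 0], the common colour of [u + t] and [u] would give
   [t = 0]. *)
have u_neq0 : u != 0.
  apply/eqP => u0; have [|k _] := cP _ _ (ut 1 _); first by rewrite inE eqxx.
  by rewrite u0 mul0r add0r; apply/eqP.
have [k k0 uk] := cP _ _ (cw (t%:R^-1 * u)).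
have {}uk : t%:R * w (c (t%:R^-1 * u)) = u * k ^+ n.
  by rewrite uk !mulrA divff// mul1r.
exists k => // s sS.
have [|l _] := cP _ _ (ut (s * w (c (t%:R^-1 * u))) _).
  by rewrite inE; apply/orP; right; apply/allpairsP; exists (s, c (t%:R^-1 * u)); rewrite ?mem_enum.
move=> e; exists l; apply: (mulfI u_neq0).
by rewrite -e mulrDr mulr1 mulrA -uk -mulrA mulr_natl [s * _]mulrC.
Qed.

End PowerClasses.

(** A common nonzero coordinate [x] forces the factor between proportional vectors to be 1, so the
    [N] vectors, told apart by coordinate [j], give [N] distinct points. *)
Lemma infinite_projective (K : fieldType) (m : nat) (A : set (proj_space K m)) :
  (forall N, exists (v : 'I_N -> 'rV[K]_m.+1) (i j : 'I_m.+1) (x : K),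
    [/\ x != 0, forall r, v r 0 i = x, injective (fun r => v r 0 j) &
      forall r (w : nonzero_vec K m), val w = v r -> A (\pi_(proj_space K m) w)]) ->
  infinite_set A.
Proof.
move=> Av /finite_seqP[s As].
have [v [i [j [x [x0 vi vj vA]]]]] := Av (size s).+1.
have v_neq0 r : v r != 0.
  by apply: contraNneq x0 => v0; rewrite -(vi r) v0 mxE.
pose p r := \pi_(proj_space K m) (exist (fun u => u != 0) (v r) (v_neq0 r)).
have p_inj : injective p.
  move=> q r /eqmodP/asboolP[k k0 /= E]; apply: vj.
  have /eqP := congr1 (fun u : 'rV_m.+1 => u 0 i) E.
  rewrite mxE !vi -subr_eq0 -{1}[x]mul1r -mulrBl mulf_eq0 (negPf x0) orbF subr_eq0.
  by move=> /eqP k1; rewrite E -k1 scale1r.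
have : (size (codom p) <= size s)%N.
  apply: uniq_leq_size; first by apply/injectiveP.
  move=> _ /codomP[r ->]; have : A (p r) by exact: vA.
  by rewrite As.
by rewrite size_codom card_ord ltnn.
Qed.

(** Addition in ['I_3] is modulo 3, so any coordinate can be put first. *)
Lemma sum_ord3 (V : zmodType) (F : 'I_3 -> V) i :
  \sum_k F k = F i + F (i + 1) + F (i + 2%:R).
Proof.
rewrite !big_ord_recl big_ord0 addr0 addrA.
case: i => [[|[|[|//]]] i3]; [|rewrite -addrA addrC|rewrite addrC addrA];
  by congr (F _ + F _ + F _); apply: val_inj.
Qed.

Lemma ord3_cases (i k : 'I_3) : [\/ k = i, k = i + 1 | k = i + 2%:R].
Proof.
have /existsP[j /eqP->] : [exists j : 'I_3, k == i + j].
  by apply/existsP; exists (k - i); rewrite addrC subrK.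
case: j => [[|[|[|//]]] j3]; [apply: Or31|apply: Or32|apply: Or33].
- by rewrite -[RHS]addr0; congr (_ + _); apply: val_inj.
- by congr (_ + _); apply: val_inj.
- by congr (_ + _); apply: val_inj.
Qed.

Section DiagonalForm.
Variables (K : fieldType) (n : nat) (A : 'I_3 -> K).
Hypotheses (charK0 : [pchar K] =i pred0) (n_gt0 : (0 < n)%N).
Hypotheses (A_neq0 : forall i, A i != 0) (fpc : finite_power_classes K n).

Definition many_zeros := forall N,
  exists (v : 'I_N -> 'rV[K]_3) (i j : 'I_3) (x : K),
    [/\ x != 0, forall r, v r 0 i = x, injective (fun r => v r 0 j) &
      forall r, \sum_k A k * v r 0 k ^+ n = 0].

(** Only the n-th powers of the varying coordinates will be explicit, so distinctness is demanded of
    these. *)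
Lemma many_zeros_coord (i : 'I_3) :
  (forall N, exists (x : K) (y z : nat -> K), [/\ x != 0,
    forall q r, (q < N)%N -> (r < N)%N -> y q ^+ n = y r ^+ n -> q = r &
    forall r, (r < N)%N ->
      A i * x ^+ n + A (i + 1) * y r ^+ n + A (i + 2%:R) * z r ^+ n = 0]) ->
  many_zeros.
Proof.
move=> H N; have [x [y [z [x0 y_inj xyz]]]] := H N.
pose v (r : 'I_N) : 'rV[K]_3 :=
  \row_k if k == i then x else if k == i + 1 then y r else z r.
have ne1 : (i + 1 == i) = false by case: i {H xyz v} => [[|[|[|]]]].
have ne2 : (i + 2%:R == i) = false by case: i {H xyz v ne1} => [[|[|[|]]]].
have ne3 : (i + 2%:R == i + 1) = false by case: i {H xyz v ne1 ne2} => [[|[|[|]]]].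
exists v, i, (i + 1), x; split=> // [r|q r|r].
- by rewrite mxE eqxx.
- rewrite !mxE ne1 eqxx => yqr; apply/val_inj/(y_inj _ _ (ltn_ord q) (ltn_ord r)).
  by rewrite yqr.
- by rewrite (sum_ord3 _ i) !mxE ne1 ne2 ne3 !eqxx xyz.
Qed.

Lemma diagonal_many_zeros (v : 'rV[K]_3) : v != 0 ->
  \sum_k A k * v 0 k ^+ n = 0 -> many_zeros.
Proof.
move=> v0 sv.
have natr_inj : injective (fun r : nat => r%:R : K).
  move=> q r; wlog qr : q r / (q <= r)%N.
    by move=> W; case: (leqP q r) => [|/ltnW] /W // W' /esym/W'.
  move=> /eqP; rewrite eq_sym -subr_eq0 -natrB// (proj1 (pcharf0P K) charK0) subn_eq0.
  by move=> rq; apply/eqP; rewrite eqn_leq qr.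
have [[i vi0]|v_neq0] := pselect (exists i, v 0 i = 0).
  apply: (@many_zeros_coord i) => N.
  set e := A (i + 1) * v 0 (i + 1) ^+ n.
  have ee : A (i + 2%:R) * v 0 (i + 2%:R) ^+ n = - e.
    move: sv; rewrite (sum_ord3 _ i) vi0 expr0n gtn_eqF// mulr0 add0r.
    by move/eqP; rewrite addrC addr_eq0 => /eqP.
  have e0 : e != 0.
    have zero j : A j * v 0 j ^+ n = 0 -> v 0 j = 0.
      by move/eqP; rewrite mulf_eq0 (negPf (A_neq0 j)) expf_eq0 n_gt0 => /eqP.
    apply: contraNneq v0 => e0; apply/eqP/rowP => k; rewrite mxE.
    have [->//|->|->] := ord3_cases i k; apply: zero => //.
    by rewrite ee e0 oppr0.
  (* Since [e * d = - A i], the difference of the terms for [r.+1] and [r] cancels [A i * k ^+ n].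
     Both occur for [r < N], hence the multipliers up to [N]. *)
  pose d := - A i / e.
  have [k [l [k0 kl]]] := power_shift charK0 fpc [seq r%:R * d | r <- iota 0 N.+1].
  have {}kl r : (r <= N)%N -> l (r%:R * d) ^+ n = 1 + k ^+ n * (r%:R * d).
    by move=> rN; rewrite kl//; apply/mapP; exists r; rewrite ?mem_iota.
  exists k, (fun r => v 0 (i + 1) * l (r.+1%:R * d)),
    (fun r => v 0 (i + 2%:R) * l (r%:R * d)); split=> //.
    move=> q r qN rN; rewrite !exprMn !kl//.
    have v1 : v 0 (i + 1) ^+ n != 0 by apply: contraNneq e0 => v1; rewrite /e v1 mulr0.
    have d0 : d != 0 by rewrite mulf_neq0 ?oppr_eq0 ?A_neq0 ?invr_eq0.
    move=> /(mulfI v1)/addrI/(mulfI (expf_neq0 n k0))/(mulIf d0)/natr_inj.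
    exact: succn_inj.
  have eXY X Y : e * (1 + X) - e * (1 + Y) = e * (X - Y).
    by rewrite -mulrBr opprD addrACA subrr add0r.
  move=> r rN; rewrite !exprMn !kl ?(ltnW rN)// ![A (_ + _) * (_ * _)]mulrA -/e ee mulNr.
  rewrite -addrA eXY -mulrBr -mulrBl -natr1 addrAC subrr add0r mul1r.
  by rewrite /d mulrCA [e * _]mulrC divfK// mulrN mulrC subrr.
apply: (@many_zeros_coord 0) => N.
have {}v_neq0 i : v 0 i != 0 by apply/eqP => vi; apply: v_neq0; exists i.
pose e i := A i * v 0 i ^+ n.
have e0 i : e i != 0 by rewrite mulf_neq0 ?expf_neq0.
(* A single call for both families makes them share the same [k], so that the mixed products of
   [e (0 + 1)] and [e (0 + 2%:R)] cancel. *)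
have [k [l [k0 kl]]] := power_shift charK0 fpc
  ([seq r%:R * e (0 + 2%:R) | r <- iota 0 N] ++ [seq r%:R * - e (0 + 1) | r <- iota 0 N]).
exists (v 0 0), (fun r => v 0 (0 + 1) * l (r%:R * e (0 + 2%:R))),
  (fun r => v 0 (0 + 2%:R) * l (r%:R * - e (0 + 1))).
have kl2 r : (r < N)%N ->
    l (r%:R * e (0 + 2%:R)) ^+ n = 1 + k ^+ n * (r%:R * e (0 + 2%:R)).
  by move=> rN; rewrite kl// mem_cat; apply/orP; left; apply/mapP; exists r; rewrite ?mem_iota.
have kl1 r : (r < N)%N -> l (r%:R * - e (0 + 1)) ^+ n = 1 + k ^+ n * (r%:R * - e (0 + 1)).
  by move=> rN; rewrite kl// mem_cat; apply/orP; right; apply/mapP; exists r; rewrite ?mem_iota.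
split=> // [q r qN rN|r rN]; rewrite !exprMn ?kl2 ?kl1//.
  move=> /(mulfI (expf_neq0 n (v_neq0 _)))/addrI/(mulfI (expf_neq0 n k0)).
  by move=> /(mulIf (e0 _))/natr_inj.
move: sv; rewrite (sum_ord3 _ 0) ![A (_ + _) * (_ * _)]mulrA -/(e _) -/(e _) -/(e _) => sv.
move: (e 0) (e (0 + 1)) (e (0 + 2%:R)) sv => x y z sv.
rewrite !mulrDr !mulr1 !addrA [X in X + _]addrAC sv add0r.
by rewrite !mulrN ![y * _]mulrCA ![z * _]mulrCA [z * y]mulrC subrr.
Qed.

End DiagonalForm.

(** * The fixed field of the absolute Galois group *)

Section FixedField.
Variables (K : fieldType) (L : closedFieldType) (iota : {rmorphism K -> L}).
Hypothesis L_alg : forall z : L, algebraicOver iota z.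
Local Notation LL := (L * L)%type.

Definition diag (x : K) : LL := (iota x, iota x).

Fact diag_is_zmod_morphism : zmod_morphism diag.
Proof. by move=> x y; rewrite /diag !rmorphB. Qed.

Fact diag_is_monoid_morphism : monoid_morphism diag.
Proof. by split=> [|x y]; rewrite /diag ?rmorph1 ?rmorphM. Qed.

HB.instance Definition _ := GRing.isZmodMorphism.Build K LL diag diag_is_zmod_morphism.
HB.instance Definition _ := GRing.isMonoidMorphism.Build K LL diag diag_is_monoid_morphism.

Lemma fst_horner (Q : {poly LL}) u : (Q.[u]).1 = (map_poly fst Q).[u.1].
Proof. by rewrite (horner_map fst). Qed.

Lemma snd_horner (Q : {poly LL}) u : (Q.[u]).2 = (map_poly snd Q).[u.2].
Proof. by rewrite (horner_map snd). Qed.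

Lemma diag_horner (q : {poly K}) u :
  (map_poly diag q).[u] = ((map_poly iota q).[u.1], (map_poly iota q).[u.2]).
Proof.
by rewrite [LHS]surjective_pairing fst_horner snd_horner -!map_poly_comp.
Qed.

(** Removing all factors [X] from an annihilating polynomial leaves [q X + c] with [c] nonzero, so
    the inverse of [z] is [- q(z) / c]. *)
Lemma algebraic_inverse z : z != 0 ->
  exists q : {poly K}, z * (map_poly iota q).[z] = 1.
Proof.
move=> z0; have [p p0 pz] := L_alg z.
have [m [q]] := multiplicity_XsubC p 0; rewrite p0 /= => q0 pq.
move: pz; rewrite pq subr0 rmorphM rmorphXn/= map_polyX rootM.
rewrite [X in _ || X]rootE hornerXn expf_eq0 (negPf z0) andbF orbF.
elim/poly_ind: q q0 {pq} => [|q c _]; first by rewrite root0.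
rewrite rootE hornerMXaddC mulr0 add0r => c0.
rewrite rmorphD rmorphM/= map_polyX map_polyC rootE hornerMXaddC addr_eq0 => /eqP qz.
exists (- c^-1 *: q); rewrite map_polyZ hornerZ mulrCA [z * _]mulrC qz.
by rewrite rmorphN fmorphV mulrNN mulVf// fmorph_eq0.
Qed.

(* The graph of a K-embedding into L of a subring of L: a function is a ring
   morphism iff its graph is a subring of L * L, and the last condition makes
   such a subring functional. *)
Definition embedding_graph (G : set LL) :=
  [/\ forall u v, G u -> G v -> G (u - v), forall u v, G u -> G v -> G (u * v),
      forall x, G (diag x) & forall y, G (0, y) -> y = 0].

Section Graph.
Variable G : set LL.
Hypothesis Ggraph : embedding_graph G.

Definition graph_pred : {pred LL} := fun u => `[< G u >].

Fact graph_subring_closed : subring_closed graph_pred.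
Proof.
have [GB GM Gd _] := Ggraph; split=> [|u v|u v]; rewrite !unfold_in.
- by apply/asboolP; rewrite -(rmorph1 diag).
- by move=> /asboolP Gu /asboolP Gv; apply/asboolP/GB.
- by move=> /asboolP Gu /asboolP Gv; apply/asboolP/GM.
Qed.

Let S : subringClosed LL :=
  HB.pack graph_pred (GRing.isSubringClosed.Build _ graph_pred graph_subring_closed).

Let SP u : reflect (G u) (u \in S).
Proof. exact: asboolP. Qed.

Let diagS (q : {poly K}) : map_poly diag q \is a polyOver S.
Proof.
by apply/polyOverP => i; rewrite coef_map; apply/SP; case: Ggraph.
Qed.

(** The inverse of [u] is [q(u)] with [q] over [K], so [v = 0] would put [(0, -1)] in the graph. *)
Lemma embedding_graph_neq0 u v : G (u, v) -> u != 0 -> v != 0.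
Proof.
have [_ _ _ G0] := Ggraph.
move=> Guv u0; apply/eqP => v0; have [q uq] := algebraic_inverse u0.
have : G ((u, v) * (map_poly diag q).[(u, v)] - 1).
  by apply/SP; rewrite rpredB ?rpred1// rpredM ?rpred_horner//; apply/SP.
have -> : (u, v) * (map_poly diag q).[(u, v)] - 1 = (0, -1).
  by rewrite diag_horner v0; congr pair; rewrite /= ?uq ?subrr// mul0r sub0r.
by move=> /G0/eqP; rewrite oppr_eq0 oner_eq0.
Qed.

(** The new graph is the subring generated by [G] and [(x, y)]; the hypothesis keeps it
    functional. *)
Lemma embedding_graph_adjoin x y :
  (forall Q, Q \is a polyOver S -> root (map_poly fst Q) x -> root (map_poly snd Q) y) ->
  exists G', [/\ embedding_graph G', G `<=` G' & G' (x, y)].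
Proof.
move=> xy; exists [set u | exists2 Q, Q \is a polyOver S & Q.[(x, y)] = u].
split; [split| |].
- by move=> _ _ [P PS <-] [Q QS <-]; exists (P - Q); rewrite ?rpredB// hornerD hornerN.
- by move=> _ _ [P PS <-] [Q QS <-]; exists (P * Q); rewrite ?rpredM// hornerM.
- by move=> z; exists (diag z)%:P; rewrite ?hornerC// polyOverC; apply/SP; case: Ggraph.
- move=> z [Q QS Qz]; have Qx : root (map_poly fst Q) x.
    by apply/rootP; rewrite -(fst_horner Q (x, y)) Qz.
  have -> : z = (Q.[(x, y)]).2 by rewrite Qz.
  by rewrite snd_horner; apply/rootP/xy.
- by move=> u Gu; exists u%:P; rewrite ?hornerC// polyOverC; apply/SP.
- by exists 'X; rewrite ?polyOverX// hornerX.
Qed.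

(** A polynomial over [G] is a polynomial paired with its conjugate. Take [P] of least size whose
    first component vanishes at [x], and let [y] be a root of the second component. *)
Lemma embedding_graph_extend x :
  exists G' y, [/\ embedding_graph G', G `<=` G' & G' (x, y)].
Proof.
pose vanish (Q : {poly LL}) := Q \is a polyOver S /\ root (map_poly fst Q) x.
have /cid2[d] : exists2 d, `[< exists P, [/\ vanish P, P != 0 & size P = d] >]
    & forall e, `[< exists P, [/\ vanish P, P != 0 & size P = e] >] -> (d <= e)%N.
  have ex : exists d, `[< exists P, [/\ vanish P, P != 0 & size P = d] >].
    have [p p0 px] := L_alg x; exists (size (map_poly diag p)); apply/asboolP.
    exists (map_poly diag p); split=> //; last by rewrite map_poly_eq0.
    by split=> //; rewrite -map_poly_comp.
  by exists (ex_minn ex); case: ex_minnP.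
move=> /asboolP[P [[PS Px] P0 <-]] Pmin {d}.
have Glead : G ((lead_coef P).1, (lead_coef P).2).
  by rewrite -surjective_pairing; apply/SP/(polyOverP PS).
have lead1 : (lead_coef P).1 != 0.
  apply: contra_neq P0 => lead1; apply/eqP; rewrite -lead_coef_eq0.
  rewrite [lead_coef P]surjective_pairing lead1; apply/eqP; congr pair.
  by have [_ _ _] := Ggraph; apply; rewrite -lead1.
have lead2 := embedding_graph_neq0 Glead lead1.
have [y Py] : exists y, root (map_poly snd P) y.
  apply/closed_rootP; rewrite size_map_poly_id0// -(size_map_poly_id0 lead1) neq_ltn.
  rewrite (@root_size_gt1 _ x) ?orbT// -size_poly_eq0 size_map_poly_id0//.
  by rewrite size_poly_eq0.
suff [G' [G'graph GG' G'xy]] : exists G', [/\ embedding_graph G', G `<=` G' & G' (x, y)].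
  by exists G', y.
apply: embedding_graph_adjoin => Q.
have [e] := ubnP (size Q); elim: e Q => // e IH Q sQ QS Qx.
have [->|Q0] := eqVneq Q 0; first by rewrite rmorph0 root0.
have PQ : (size P <= size Q)%N by apply: Pmin; apply/asboolP; exists Q.
have [d sP] : exists d, size P = d.+1 by exists (size P).-1; rewrite prednK ?size_poly_gt0.
have [m sQm] : exists m, size Q = (m + d).+1.
  by exists (size Q - size P)%N; rewrite -addnS -sP subnK.
(* Pseudo-division, as [G] is only a ring: induction applies to [R], and [lead2] then carries the
   vanishing at [y] over to [Q]. *)
pose R := (lead_coef P)%:P * Q - (lead_coef Q)%:P * 'X^m * P.
have RS : R \is a polyOver S.
  by rewrite rpredB ?rpredM ?polyOverC ?polyOverXn//; apply/polyOverP.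
have Rsize : (size R < size Q)%N.
  rewrite sQm ltnS; apply/leq_sizeP => j.
  rewrite leq_eqVlt /R -mulrA coefB !coefCM coefXnM => /predU1P[<-|jQ].
    by rewrite ltnNge leq_addr addKn !lead_coefE sQm sP mulrC subrr.
  rewrite !nth_default ?mulr0 ?if_same ?mulr0 ?subrr// ?sQm// sP.
  by rewrite ltn_subRL.
have Rx : root (map_poly fst R) x.
  by rewrite rmorphB !rmorphM/= rootE hornerD hornerN !hornerM (rootP Qx) (rootP Px) !mulr0 subrr.
have := IH R (leq_trans Rsize sQ) RS Rx.
rewrite rmorphB !rmorphM/= rootE hornerD hornerN !hornerM (rootP Py) mulr0 subr0.
by rewrite map_polyC hornerC mulf_eq0 (negPf lead2).
Qed.

End Graph.

Lemma embedding_graph_bigcup (F : set (set LL)) (G0 : set LL) :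
  F G0 -> total_on F subset -> (forall X, F X -> embedding_graph X) ->
  embedding_graph (\bigcup_(X in F) X).
Proof.
move=> FG0 Ftot Fgraph.
have F2 u v : (\bigcup_(X in F) X) u -> (\bigcup_(X in F) X) v ->
    exists X, [/\ F X, X u & X v].
  move=> [X FX Xu] [Y FY Yv].
  by have [/(_ u Xu)|/(_ v Yv)] := Ftot _ _ FX FY; [exists Y|exists X].
split.
- move=> u v Fu Fv; have [X [FX Xu Xv]] := F2 _ _ Fu Fv.
  by exists X => //; have [XB _ _ _] := Fgraph _ FX; exact: XB.
- move=> u v Fu Fv; have [X [FX Xu Xv]] := F2 _ _ Fu Fv.
  by exists X => //; have [_ XM _ _] := Fgraph _ FX; exact: XM.
- by move=> x; exists G0 => //; have [_ _ Xd _] := Fgraph _ FG0; exact: Xd.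
- by move=> y [X FX Xy]; have [_ _ _ X0] := Fgraph _ FX; exact: X0.
Qed.

Lemma embedding_graph_total (G0 : set LL) : embedding_graph G0 ->
  exists G, [/\ embedding_graph G, G0 `<=` G & forall x, exists y, G (x, y)].
Proof.
move=> G0graph; pose P (G : set LL) := G = set0 \/ (embedding_graph G /\ G0 `<=` G).
have G00 : G0 !=set0 by exists (diag 0); case: G0graph.
have [F FP Ftot|G [GP Gmax]] := @Zorn_bigcup _ P.
  have [[X [FX XN]]|FN] := pselect (exists X, F X /\ X <> set0); last first.
    left; apply/seteqP; split=> // u [X FX Xu]; apply: FN; exists X; split=> // X0.
    by rewrite X0 in Xu.
  right; have [//|[Xgraph G0X]] := FP _ FX; split; last first.
    by move=> u /G0X Xu; exists X.
  have -> : \bigcup_(Y in F) Y = \bigcup_(Y in F `&` [set Y | Y <> set0]) Y.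
    apply/seteqP; split=> u [Y]; last by case=> FY _ Yu; exists Y.
    by move=> FY Yu; exists Y => //; split=> // Y0; rewrite Y0 in Yu.
  apply: (@embedding_graph_bigcup _ X) => //.
    by move=> Y Z [FY _] [FZ _]; exact: Ftot.
  by move=> Y [FY YN]; have [//|[]] := FP _ FY.
have [Gempty|[Ggraph G0G]] := GP.
  exfalso; apply: (Gmax G0); last by right; split=> // u.
  by rewrite Gempty; split=> // G0s; case: G00 => u /G0s.
exists G; split=> // x; have [G' [y [G'graph GG' G'xy]]] := embedding_graph_extend Ggraph x.
exists y; apply: contrapT => GN; apply: (Gmax G'); first by split=> // /(_ _ G'xy).
by right; split=> //; exact: subset_trans GG'.
Qed.

(** Being injective, [s] permutes the finitely many roots of a polynomial over [K] that annihilates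
    [y], so [y] is attained. *)
Lemma algebraic_endo_bij (s : {rmorphism L -> L}) :
  (forall x, s (iota x) = iota x) -> bijective s.
Proof.
move=> s_fix.
have s_surj y : exists x, s x = y.
  have [p p0 py] := L_alg y.
  have [r pr] := closed_field_poly_normal (map_poly iota p).
  have q0 : map_poly iota p != 0 by rewrite map_poly_eq0.
  have rootr z : root (map_poly iota p) z = (z \in undup r).
    by rewrite mem_undup pr rootZ ?root_prod_XsubC// lead_coef_eq0.
  have sr : {subset map s (undup r) <= undup r}.
    move=> _ /mapP[z + ->]; rewrite -!rootr => pz.
    have -> : map_poly iota p = map_poly s (map_poly iota p).
      by rewrite -map_poly_comp; apply: eq_map_poly => x; rewrite /= s_fix.
    by rewrite mapf_root.
  have us : uniq (map s (undup r)) by rewrite map_inj_uniq ?undup_uniq//; exact: fmorph_inj.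
  have [_ E] := uniq_min_size us sr (eq_leq (esym (size_map s _))).
  by move: py; rewrite rootr -E => /mapP[x _ ->]; exists x.
have [t ts] := choice s_surj.
by exists t => // x; apply: (fmorph_inj s); rewrite ts.
Qed.

Lemma graph_automorphism (G0 : set LL) : embedding_graph G0 ->
  exists s : galois_aut iota, forall x y, G0 (x, y) -> s x = y.
Proof.
move=> /embedding_graph_total[G [[GB GM Gd Gz]] G0G /choice[f fG]].
have fE x y : G (x, y) -> f x = y.
  move=> Gxy; apply/eqP; rewrite -subr_eq0; apply/eqP/Gz.
  by rewrite -(subrr x); exact: GB _ _ (fG x) Gxy.
have fB : zmod_morphism f by move=> x y; apply: fE; exact: GB _ _ (fG x) (fG y).
have fM : monoid_morphism f.
  split; last by move=> x y; apply: fE; exact: GM _ _ (fG x) (fG y).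
  by apply: fE; have := Gd 1; rewrite /diag rmorph1.
pose f1 := GRing.isZmodMorphism.Build L L f fB.
pose f2 := GRing.isMonoidMorphism.Build L L f fM.
pose s : {rmorphism L -> L} := HB.pack f f1 f2.
have s_fix x : s (iota x) = iota x by exact: (fE _ _ (Gd x)).
by exists (GaloisAut (algebraic_endo_bij s_fix) s_fix) => x y /G0G/fE.
Qed.

Hypothesis charK0 : [pchar K] =i pred0.

(** If the minimal polynomial [p] of [w] is not linear, it has a second root [w'] by separability,
    and an automorphism takes [w] to [w']. *)
Theorem fixed_field w : (forall s : galois_aut iota, s w = w) -> exists k, w = iota k.
Proof.
move=> sw; pose P d := `[< exists p : {poly K},
  [/\ p != 0, root (map_poly iota p) w & size p = d] >].
have exP : exists d, P d.
  by have [p p0 pw] := L_alg w; exists (size p); apply/asboolP; exists p.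
case: (ex_minnP exP) => d /asboolP[p [p0 pw <-]] pmin {d}.
have {}pmin q : root (map_poly iota q) w -> p %| q.
  move=> qw; apply/modp_eq0P; have [//|r0] := eqVneq (q %% p) 0.
  have : (size (q %% p)%R < size p)%N by rewrite ltn_modp.
  rewrite ltnNge pmin//; apply/asboolP; exists (q %% p); split=> //.
  rewrite rootE; move/rootP: qw; rewrite {1}(divp_eq q p) rmorphD rmorphM.
  by rewrite hornerD hornerM (rootP pw) mulr0 add0r => ->.
have p1 : (1 < size p)%N.
  by rewrite -(size_map_poly iota) (root_size_gt1 _ pw)// map_poly_eq0.
have p'0 : p^`() != 0.
  apply: contraNneq p0 => /polyP/(_ (size p).-2); rewrite coef_deriv coef0.
  case: (size p) p1 (lead_coefE p) => [|[|d]]//= _ <- /eqP.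
  rewrite -mulr_natr mulf_eq0 (proj1 (pcharf0P K) charK0) orbF.
  by rewrite lead_coef_eq0.
have [sp|sp] := eqVneq (size p) 2%N.
  have lp : p`_1 != 0 by rewrite -[1%N]/(2.-1)%N -sp -lead_coefE lead_coef_eq0.
  exists (- p`_0 / p`_1); apply: (mulIf (x := iota p`_1)); first by rewrite fmorph_eq0.
  rewrite -rmorphM divfK// rmorphN; apply/eqP; rewrite -addr_eq0 addrC mulrC.
  move: pw; rewrite rootE horner_coef size_map_poly sp !big_ord_recl big_ord0.
  by rewrite !coef_map expr0 mulr1 expr1 addr0.
have [w' ww' pw'] : exists2 w', w' != w & root (map_poly iota p) w'.
  have [g pg] := factor_theorem _ _ pw.
  (* A double root would also be a root of the derivative, which [p] would then divide despite its
     smaller degree. *)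
  have gw : ~~ root g w.
    apply/negP => gw; have : p %| p^`().
      apply: pmin; rewrite -deriv_map pg derivM derivXsubC mulr1.
      by rewrite rootE hornerD hornerM hornerXsubC subrr mulr0 add0r.
    by move=> /(dvdp_leq p'0); rewrite leqNgt lt_size_deriv.
  have /closed_rootP[w' gw'] : size g != 1%N.
    apply: contraNneq sp => g1; rewrite -(size_map_poly iota) pg.
    by rewrite size_Mmonic ?monicXsubC -?size_poly_eq0 ?g1// size_XsubC.
  exists w'; first by apply: contraNneq gw => <-.
  by rewrite pg rootM gw'.
(* The graph of the map from [K[w]] to [K[w']]; it is functional because [p] divides every [q] with
   [q(w) = 0]. *)
have [|s /(_ w w')ss] := @graph_automorphism [set (map_poly diag q).[(w, w')] | q in setT].
  split.
  - by move=> _ _ [q _ <-] [r _ <-]; exists (q - r) => //; rewrite rmorphB hornerD hornerN.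
  - by move=> _ _ [q _ <-] [r _ <-]; exists (q * r) => //; rewrite rmorphM hornerM.
  - by move=> x; exists x%:P => //; rewrite map_polyC hornerC.
  - move=> y [q _]; rewrite diag_horner => -[/rootP/pmin/dvdpP[r ->] <-].
    by rewrite rmorphM hornerM (rootP pw') mulr0.
move: ww'; rewrite -ss ?sw ?eqxx//; exists 'X => //.
by rewrite map_polyX hornerX.
Qed.
End FixedField.

(** * Kummer theory *)

Section Kummer.
Variables (K : fieldType) (L : closedFieldType) (iota : {rmorphism K -> L}).
Hypothesis L_alg : forall z : L, algebraicOver iota z.
Local Notation G := (galois_aut iota).

Lemma krull_coset_open (U : set G) : krull_cosets U -> open U.
Proof.
move=> UK; exists [set U]; last by rewrite bigcup_set1.
by move=> _ ->; exact: finI_from1.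
Qed.

Definition simple_extension (w : L) : {pred L} :=
  [pred z | `[< exists q : {poly K}, z = (map_poly iota q).[w] >]].

Lemma simple_extensionP w z :
  reflect (exists q : {poly K}, z = (map_poly iota q).[w]) (z \in simple_extension w).
Proof. exact: asboolP. Qed.

Lemma mem_simple_extension w : w \in simple_extension w.
Proof. by apply/simple_extensionP; exists 'X; rewrite map_polyX hornerX. Qed.

(** Inverses in [K[w]] are again polynomials in [w], and reduction modulo an annihilating [p] bounds
    the powers of [w] that span. *)
Lemma simple_extension_finite w : finite_subextension iota (simple_extension w).
Proof.
split.
- split.
  + by apply/simple_extensionP; exists 1; rewrite rmorph1 hornerC.
  + move=> _ _ /simple_extensionP[p ->] /simple_extensionP[q ->].
    by apply/simple_extensionP; exists (p - q); rewrite rmorphB hornerD hornerN.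
  + move=> _ _ /simple_extensionP[p ->] /simple_extensionP[q ->].
    have [q0|q0] := eqVneq (map_poly iota q).[w] 0.
      by rewrite q0 invr0 mulr0; apply/simple_extensionP; exists 0; rewrite rmorph0 horner0.
    have [r qr] := algebraic_inverse L_alg q0.
    apply/simple_extensionP; exists (p * (r \Po q)).
    rewrite rmorphM/= hornerM map_comp_poly horner_comp.
    by congr (_ * _); apply: (mulfI q0); rewrite mulfV.
- by move=> x; apply/simple_extensionP; exists x%:P; rewrite map_polyC hornerC.
- have [p p0 pw] := L_alg w.
  exists (size p), [tuple w ^+ i | i < size p]; split.
    move=> _ /mapP[i _ ->]; apply/simple_extensionP; exists 'X^i.
    by rewrite map_polyXn hornerXn.
  move=> _ /simple_extensionP[q ->].
  exists (fun i => (q %% p)`_i).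
  rewrite {1}(divp_eq q p) rmorphD rmorphM hornerD hornerM (rootP pw) mulr0 add0r.
  rewrite (@horner_coef_wide _ (size p)).
    by apply: eq_bigr => i _; rewrite coef_map tnth_mktuple.
  by rewrite size_map_poly ltnW// ltn_modp.
Qed.

(** The open coset of [s] modulo the subgroup fixing [K[w]] meets the generated subgroup, which lies
    in the stabiliser of [w]. *)
Lemma dense_fixed (S : set G) w : dense (generated_subgroup S) ->
  (forall s, S s -> s w = w) -> forall s : G, s w = w.
Proof.
move=> Sdense Sw s.
have [] := Sdense [set (s * t)%g | t in fixing_subgroup (simple_extension w)].
- by exists (s * 1)%g; exists 1%g.
- apply: krull_coset_open; exists s, (simple_extension w); split=> //.
  exact: simple_extension_finite.
move=> _ [[t tw <-] /(_ [pred u : G | u w == w])].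
have stab : group_closed [pred u : G | u w == w].
  split; first by rewrite inE.
  move=> u v; rewrite !inE => /eqP uw /eqP vw; apply/eqP.
  have vw' : (v^-1)%g w = w.
    by rewrite -{1}vw; exact: (congr1 (fun u : G => u w) (mulVg v)).
  by rewrite -[RHS]uw -[in RHS]vw'.
move=> /(_ _)/eqP H.
have : s (t w) = w by apply: H; split=> // u /Sw/eqP.
by rewrite tw// mem_simple_extension.
Qed.

Theorem finite_power_classes_of_fg n : (0 < n)%N -> [pchar K] =i pred0 ->
  galois_topologically_fg iota -> finite_power_classes K n.
Proof.
move=> n0 charK0 [S [/finite_seqP[gs Sgs] Sdense]].
have /choice[rt rtP] : forall x : K, exists y : L, y ^+ n = iota x.
  move=> x.
  have /closed_rootP[y] : size ('X^n - (iota x)%:P) != 1%N.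
    by rewrite size_XnsubC// eqSS -lt0n.
  by rewrite rootE hornerD hornerN hornerXn hornerC subr_eq0 => /eqP; exists y.
have rt0 x : (rt x == 0) = (x == 0).
  by rewrite -(fmorph_eq0 iota) -rtP expf_eq0 n0.
have unityP : 'X^n - 1%:P != 0 :> {poly L} by rewrite -size_poly_eq0 size_XnsubC.
have [us usP] : exists us : seq L, forall z, z ^+ n = 1 -> z \in us.
  have [us def_us] := closed_field_poly_normal ('X^n - 1%:P : {poly L}).
  exists us => z zn; rewrite -root_prod_XsubC -(@rootZ _ _ (lead_coef ('X^n - 1%:P))).
    by rewrite -def_us rootE hornerD hornerN hornerXn hornerC zn subrr.
  by rewrite lead_coef_eq0.
(* The colour singles out 0 and records, for each generator, the position in [us] of its Kummer
   character at [x]. There is one extra value because [index] returns [size us] on elements not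
   listed. *)
pose c (x : K) : bool * {ffun 'I_(size gs) -> 'I_(size us).+1} :=
  (x == 0, [ffun i => inord (index (tnth (in_tuple gs) i (rt x) / rt x) us)]).
exists (bool * {ffun 'I_(size gs) -> 'I_(size us).+1})%type, c => x y [xy0 /ffunP xy].
have [x0|x0] := eqVneq x 0.
  by exists 1; rewrite ?oner_eq0// expr1n mulr1 x0; apply/esym/eqP; rewrite -xy0 x0.
have y0 : y != 0 by rewrite -xy0.
have sxy s : S s -> s (rt x) / rt x = s (rt y) / rt y.
  rewrite Sgs => /(nthP s)[i igs <-].
  have := xy (Ordinal igs); rewrite !ffunE !(tnth_nth s) => /(congr1 (@nat_of_ord _)).
  have inus z : z != 0 -> (nth s gs i) (rt z) / rt z \in us.
    move=> z0; apply: usP.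
    by rewrite expr_div_n -rmorphXn rtP aut_fix divff// fmorph_eq0.
  rewrite !inordK ?ltnS ?index_size//.
  by move=> /(congr1 (nth 0 us)); rewrite !nth_index ?inus.
have [k kP] : exists k, rt x / rt y = iota k.
  apply: (fixed_field L_alg charK0); apply: (dense_fixed Sdense) => s /sxy.
  move=> /eqP; rewrite eqr_div ?rt0// => /eqP E.
  by apply/eqP; rewrite rmorphM fmorphV eqr_div ?fmorph_eq0 ?rt0// E mulrC.
have rk : rt x = rt y * iota k by rewrite -kP mulrC divfK ?rt0.
exists k.
  by rewrite -(fmorph_eq0 iota) -kP mulf_neq0 ?invr_eq0 ?rt0.
by apply: (fmorph_inj iota); rewrite -rtP rk exprMn rtP rmorphM rmorphXn.
Qed.

End Kummer.

(** * From diagonal forms back to the Fermat curve *)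

Theorem theorem2 (a b c : rat) (n : nat)
    (a_neq0 : a != 0) (b_neq0 : b != 0) (c_neq0 : c != 0) (n_gt0 : (0 < n)%N)
    (K : fieldType) (charK0 : [pchar K] =i pred0)
    (Kbar : closedFieldType) (iota : {rmorphism K -> Kbar})
    (Kbar_algebraic : forall z : Kbar, algebraicOver iota z)
    (GK_fg : galois_topologically_fg iota) :
  fermat_points a b c n (K := K) !=set0 ->
  infinite_set (fermat_points a b c n (K := K)).
Proof.
move=> [_ [v /= v0 _]].
have fpc := finite_power_classes_of_fg Kbar_algebraic n_gt0 charK0 GK_fg.
pose A (i : 'I_3) : K := tnth [tuple ratr a; ratr b; ratr c] i.
(* In characteristic 0 the numerator and the denominator of a nonzero rational stay nonzero in [K],
   hence so does its image under [ratr]. *)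
have intr_neq0 (z : int) : z != 0 -> z%:~R != 0 :> K.
  case: z => m; rewrite ?NegzE ?mulrNz ?oppr_eq0 -pmulrn.
    by rewrite (proj1 (pcharf0P K) charK0).
  by rewrite (proj1 (pcharf0P K) charK0).
have ratr_neq0 (q : rat) : q != 0 -> ratr q != 0 :> K.
  by move=> q0; rewrite mulf_neq0 ?invr_eq0// intr_neq0 ?numq_eq0 ?denq_neq0.
have A_neq0 i : A i != 0.
  by case: i => [[|[|[|//]]] i3]; exact: ratr_neq0.
have formE (u : 'rV[K]_3) : fermat_form a b c n u = \sum_k A k * u 0 k ^+ n.
  by rewrite (sum_ord3 _ 0) !add0r /A !(tnth_nth 0).
apply: infinite_projective => N.
have [|u [i [j [x [x0 ui uj u0]]]]] :=
  @diagonal_many_zeros K n A charK0 n_gt0 A_neq0 fpc (val v) (valP v) _ N.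
  by rewrite -formE.
exists u, i, j, x; split=> // r w wu.
by apply/fermat_points_pi; rewrite wu formE.
Qed.
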